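(* Let $q\ge 1$ and $n\ge \ell\ge 2$ be integers and let $\mathbf{t}=(t_1,\dots,t_q)$ be a vector of positive integers. Then there exist integers $x,y$ with $1\le x\le 2\|\mathbf{t}\|_\infty-1$ and $0\le y\le n-x$ such that $G_{n,x,y}\not\to \mathbf{t}K_2$ and \[ m_\ell(G_{n,x,y})=\mathbf{GRT}_\ell(n\to \mathbf{t}K_2). \]
   Context: For graphs $T,G$, $m_T(G)$ is the number of unlabelled copies of $T$ in $G$, and $m_\ell=m_{K_\ell}$. For a graph $G$ and $\mathbf{t}=(t_1,\dots,t_q)$ of positive integers, $G\to\mathbf{t}K_2$ means that every $q$-edge-colouring of $G$ contains, for some $j\in[q]$, a matching of size $t_j$ all of whose edges have colour $j$; $G\not\to\mathbf{t}K_2$ is its negation. Define $\mathbf{GRT}_\ell(n\to\mathbf{t}K_2)=\max\{m_\ell(G): |V(G)|=n,\ G\not\to\mathbf{t}K_2\}$. $\|\mathbf{t}\|_\infty=\max_j t_j$. For integers $x,y\ge 0$ with $x+y\le n$, $G_{n,x,y}$ is the $n$-vertex graph on a vertex set partitioned into disjoint sets $X,Y,Z$ with $|X|=x$, $|Y|=y$, in which $\{u,v\}$ is an edge iff either $u,v\in X$ or $\{u,v\}\cap Y\neq\varnothing$ (the join of $K_y$ with the disjoint union of $K_x$ and $n-x-y$ isolated vertices). *)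

(* Defs.v *)
From HB Require Import structures.
From mathcomp Require Import all_boot.

Set Implicit Arguments.
Unset Strict Implicit.
Unset Printing Implicit Defensive.

(* A finite simple graph on V is given by its edge set, a set of
   two-element subsets of V. *)
Record graph (V : finType) : Type := Graph {
  edges : {set {set V}};
  edges_card2 : [forall e in edges, #|e| == 2]
}.

HB.instance Definition _ (V : finType) := [isSub for @edges V].
HB.instance Definition _ (V : finType) := [Finite of graph V by <:].

Section MkGraph.
Variables (V : finType) (P : pred {set V}).

Fact mk_graph_card2 :
  [forall e in [set e : {set V} | (#|e| == 2) && P e], #|e| == 2].
Proof. by apply/forall_inP => e; rewrite inE => /andP[]. Qed.

Definition mk_graph : graph V := Graph mk_graph_card2.
End MkGraph.

Definition complete_graph (l : nat) : graph 'I_l := mk_graph predT.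

(* The copies of T in G: all subgraphs (vertex set, edge set) of G that are
   the image of T under an injective map of vertices. *)
Definition copies (U V : finType) (T : graph U) (G : graph V) :
    {set {set V} * {set {set V}}} :=
  [set (f @: [set: U], [set f @: (e : {set U}) | e in edges T])
     | f : {ffun U -> V}
     & injectiveb f && ([set f @: (e : {set U}) | e in edges T] \subset edges G)].

Definition num_copies (U V : finType) (T : graph U) (G : graph V) : nat :=
  #|copies T G|.

Definition num_cliques (l : nat) (V : finType) (G : graph V) : nat :=
  num_copies (complete_graph l) G.

Definition edge (V : finType) (G : graph V) : finType :=
  {e : {set V} | e \in edges G}.

Definition is_matching (V : finType) (G : graph V) (M : {set edge G}) : bool :=
  [forall e in M, forall f in M, (e != f) ==> [disjoint val e & val f]].

(* G -> t K_2 *)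
Definition arrows (V : finType) (G : graph V) (q : nat) (t : 'I_q -> nat) : bool :=
  [forall c : {ffun edge G -> 'I_q},
    exists j : 'I_q, exists M : {set edge G},
      [&& is_matching M, #|M| == t j & [forall e in M, c e == j]]].

(* For q > 0 and positive t the edgeless graph is in the range, so this is a
   maximum over a nonempty set. *)
Definition GRT (l n q : nat) (t : 'I_q -> nat) : nat :=
  \max_(G : graph 'I_n | ~~ arrows G t) num_cliques l G.

(* X is the set of the first x vertices and Y that of the next y vertices;
   only meaningful for x + y <= n. *)
Definition Gnxy (n x y : nat) : graph 'I_n :=
  let X := [set i : 'I_n | i < x] in
  let Y := [set i : 'I_n | x <= i < x + y] in
  mk_graph (fun e => (e \subset X) || (e :&: Y != set0)).

(* Main.v *)
Require Import Defs.
From mathcomp Require Import all_boot zify.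

Set Implicit Arguments.
Unset Strict Implicit.
Unset Printing Implicit Defensive.

(* Let N be the sum of the t_j - 1.  By Gallai's lemma, a colour class without
   a matching of size t_j has a set S_j and a number a_j, |S_j| + a_j <= t_j - 1,
   such that at most (2 a_j + 1)(t_j - 1 - |S_j|) of its edges avoid S_j.  With
   Y the union of the S_j and a the maximum of the a_j, at most
   (2 a + 1)(N - |Y|) <= 'C(2 a + 1 + b, 2) edges of G avoid Y, where
   b = N - |Y| - a.  By Kruskal-Katona G - Y then has at most as many r-cliques,
   r >= 2, as a complete graph on 2 a + 1 + b vertices, so G has at most as many
   l-cliques as Gnxy n (2 a + 1) (N - a).  The latter does not arrow: a colour
   with t_j > a takes all edges inside X, and the vertices of Y are distributed
   over the colours, the edges at a vertex of Y taking its colour. *)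

(** * Matchings *)

Section EdgeSets.
Variable V : finType.
Implicit Types (E M N : {set {set V}}) (S K e f : {set V}) (u v w x y : V).

Definition uniform2 E := forall e, e \in E -> #|e| = 2.

Definition neighbours E v : {set V} := [set w | [set v; w] \in E].

Definition delete E S : {set {set V}} := [set e in E | [disjoint e & S]].

Lemma delete_sub E S : delete E S \subset E.
Proof. by apply/subsetP => e; rewrite inE => /andP[]. Qed.

Lemma uniform2_sub E E' : E' \subset E -> uniform2 E -> uniform2 E'.
Proof. by move=> /subsetP sE uE e /sE /uE. Qed.

Lemma neighbours_irrefl E v : uniform2 E -> v \notin neighbours E v.
Proof.
by move=> uE; rewrite inE setUid; apply/negP => /uE; rewrite cards1.
Qed.

Lemma edge_pair e x : #|e| = 2 -> x \in e -> exists2 y, y != x & e = [set x; y].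
Proof.
move=> /eqP/cards2P[a [b [nab ->]]]; rewrite !inE => /orP[] /eqP ->.
  by exists b => //; rewrite eq_sym.
by exists a => //; rewrite setUC.
Qed.

Lemma set2_injr x : injective (fun y => [set x; y]).
Proof.
move=> y z /setP eyz.
have := eyz y; have := eyz z; rewrite !inE !eqxx !orbT.
case: (eqVneq z x) => [->|_ /= /eqP-> //].
by rewrite orbb => _ /esym/eqP.
Qed.

Lemma card_neighbours E v :
  uniform2 E -> #|[set e in E | v \in e]| = #|neighbours E v|.
Proof.
move=> uE; rewrite -(card_imset _ (@set2_injr v)); apply: eq_card => e.
rewrite inE; apply/andP/imsetP => [[eE ve]|[w]].
  have [y _ defe] := edge_pair (uE e eE) ve.
  by exists y; rewrite // inE -defe.
by rewrite inE => vwE ->; rewrite !inE eqxx.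
Qed.

Lemma handshake E : uniform2 E -> \sum_v #|neighbours E v| = 2 * #|E|.
Proof.
move=> uE; under eq_bigr => v _ do rewrite -card_neighbours // -sum1_card.
rewrite (exchange_big_dep (mem E)) /=; last by move=> v e _; rewrite inE => /andP[].
rewrite mulnC -sum_nat_const; apply: eq_bigr => e eE.
rewrite sum1dep_card -(uE e eE); apply: eq_card => v.
by rewrite !inE eE.
Qed.

Lemma trivIset_eq M e f x :
  trivIset M -> e \in M -> f \in M -> x \in e -> x \in f -> e = f.
Proof.
by move=> tM eM fM xe xf; rewrite -(def_pblock tM eM xe) (def_pblock tM fM xf).
Qed.

Lemma trivIset_sub M N : N \subset M -> trivIset M -> trivIset N.
Proof.
move=> /subsetP sNM /trivIsetP tM; apply/trivIsetP => A B AN BN.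
by apply: tM; apply: sNM.
Qed.

Lemma card_cover_matching M : uniform2 M -> trivIset M -> #|cover M| = #|M| * 2.
Proof.
move=> uM /eqP <-; rewrite -sum_nat_const.
by apply: eq_bigr => e eM; rewrite uM.
Qed.

(** Every edge of M contains a point of S, and disjoint edges share none. *)
Lemma leq_card_transversal M S :
  trivIset M -> (forall e, e \in M -> e :&: S != set0) -> #|M| <= #|S|.
Proof.
move=> tM hM; rewrite -!sum1_card.
apply: (@leq_trans (\sum_(e in M) \sum_(x in e :&: S) 1)).
  by apply: leq_sum => e eM; rewrite sum1_card card_gt0 hM.
rewrite (exchange_big_dep (mem S)) /=; last by move=> e x _ /setIP[].
apply: leq_sum => x xS; rewrite sum1dep_card; apply/card_le1_eqP => e f.
rewrite !inE => /and3P[eM xe _] /and3P[fM xf _].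
exact: trivIset_eq tM fM eM xf xe.
Qed.

(** * Gallai's lemma and the resulting edge bound *)

Section Gallai.
Variables (E : {set {set V}}) (T : nat).
Hypothesis uE : uniform2 E.
Hypothesis maxT : forall M, M \subset E -> trivIset M -> #|M| <= T.

(** T is only known to bound the sizes of matchings; no set qualifies unless the bound is
    attained. *)
Definition max_matching M := [&& M \subset E, trivIset M & #|M| == T].

(** Otherwise [e |: M] would be a matching with T + 1 edges. *)
Lemma max_matching_meets M e :
  max_matching M -> e \in E -> exists2 x, x \in e & x \in cover M.
Proof.
case/and3P=> sME tM /eqP cM eE.
have [/eqP e0|/set0Pn[x]] := boolP (e :&: cover M == set0); last first.
  by rewrite inE => /andP[xe xM]; exists x.
have nonempty f : f \in E -> f != set0.
  by move=> fE; rewrite -card_gt0 (uE fE).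
have eM : e \notin M.
  apply/negP => eM; case/set0Pn: (nonempty e eE) => x xe.
  have: x \in e :&: cover M by rewrite inE xe; apply/bigcupP; exists e.
  by rewrite e0 inE.
have: #|e |: M| <= T.
  apply: maxT; first by rewrite subUset sub1set eE.
  apply/trivIsetP => A B; rewrite !in_setU1.
  have dis f : f \in M -> [disjoint e & f].
    move=> fM; rewrite -setI_eq0 -subset0 -e0; apply: setIS.
    exact: bigcup_sup.
  case/orP=> [/eqP->|AM] /orP[/eqP->|BM]; rewrite ?eqxx // => nAB.
  - exact: dis.
  - by rewrite disjoint_sym dis.
  - by move/trivIsetP: tM; apply.
by rewrite cardsU1 eM cM add1n ltnn.
Qed.

(* If N misses v, exchanging one of its edges for an edge of M increases the
   overlap with M while N still misses v, hence still covers u and w. *)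
Lemma max_matching_exchange M u v w :
    max_matching M -> u \notin cover M -> w \notin cover M -> u != w ->
    v \in cover M ->
    (forall N, max_matching N -> v \notin cover N ->
       (u \in cover N) && (w \in cover N)) ->
  forall N, max_matching N -> v \in cover N.
Proof.
move=> mM uM wM nuw vM covN N mN; apply/negPn/negP => vN.
have [k] := ubnP (T - #|M :&: N|); elim: k N mN vN => // k IH N mN vN hk.
case/and3P: (mM) => sME tM /eqP cM; case/and3P: (mN) => sNE tN /eqP cN.
have /andP[uN wN] := covN N mN vN.
(* Both matchings cover 2T vertices. Since u and w are covered by N only, at least two vertices are
   covered by M only: v and some further x. *)
have cardD : #|cover M :\: cover N| = #|cover N :\: cover M|.
  have c1 := cardsID (cover N) (cover M).
  have c2 := cardsID (cover M) (cover N).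
  rewrite card_cover_matching // ?cM in c1; last exact: uniform2_sub sME uE.
  rewrite card_cover_matching // ?cN in c2; last exact: uniform2_sub sNE uE.
  by apply: (@addnI #|cover M :&: cover N|); rewrite c1 setIC c2.
have: 1 < #|cover M :\: cover N|.
  rewrite cardD.
  have -> : 2 = #|[set u; w]| by rewrite cards2 nuw.
  by apply: subset_leq_card; apply/subsetP => z /set2P[] ->;
    rewrite inE ?uM ?wM.
rewrite (cardsD1 v) inE vM vN /= add1n ltnS card_gt0 => /set0Pn[x].
rewrite !inE => /and3P[nxv xN /bigcupP[e eM xe]].
have eE := subsetP sME e eM.
have [y ye yN] := max_matching_meets mN eE.
case/bigcupP: (yN) => f fN yf.
have nyx : y != x by apply: contraNneq xN => <-.
have defe : e = [set x; y].
  have [z nzx dz] := edge_pair (uE eE) xe.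
  by move: ye; rewrite dz !inE (negPf nyx) => /eqP->.
have xf : x \notin f by apply: contra xN => xf; apply/bigcupP; exists f.
have eN : e \notin N by apply: contra xN => eN; apply/bigcupP; exists e.
have fM : f \notin M.
  by apply: contra xf => fM; rewrite (trivIset_eq tM fM eM yf ye).
have disg g : g \in N -> g != f -> [disjoint e & g].
  move=> gN ngf; rewrite defe disjoint_sym -setI_eq0; apply/eqP/setP => z.
  rewrite !inE; apply/negP => /andP[zg /orP[]/eqP ez]; subst z.
    by case/bigcupP: xN; exists g.
  by move/eqP: ngf; apply; apply: trivIset_eq gN fN zg yf.
(* The M-edge [e = [set x; y]] replaces the N-edge f at y. Since f is not in M, the overlap with M
   grows; v stays uncovered because x differs from v and y is covered by N. *)
pose N' := e |: (N :\ f).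
have mN' : max_matching N'.
  apply/and3P; split.
  - rewrite subUset sub1set eE /=.
    by apply: subset_trans sNE; apply: subsetDl.
  - apply/trivIsetP => A B; rewrite !inE.
    case/orP=> [/eqP->|/andP[nA AN]] /orP[/eqP->|/andP[nB BN]]; rewrite ?eqxx // => nAB.
    + exact: disg.
    + by rewrite disjoint_sym disg.
    + by move/trivIsetP: tN; apply.
  - rewrite cardsU1 !inE (negPf eN) andbF /=.
    by move: (cardsD1 f N); rewrite fN cN => ->.
apply: (IH N') => //.
- apply/bigcupP => -[g]; rewrite !inE => /orP[/eqP->|/andP[_ gN] vg].
    rewrite defe !inE eq_sym (negPf nxv) /= => /eqP vy.
    by rewrite vy yN in vN.
  by case/bigcupP: vN; exists g.
- have : #|M :&: N| < #|M :&: N'|.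
    apply: proper_card; apply/properP; split.
      apply/subsetP => g; rewrite !inE => /andP[gM gN]; rewrite gM gN andbT /=.
      by apply/orP; right; apply: contraNneq fM => <-.
    by exists e; rewrite !inE ?eqxx ?eM // (negPf eN).
  have : #|M :&: N'| <= T by rewrite -cM subset_leq_card // subsetIl.
  by move: hk; move: #|_| #|_| => i j; clear; lia.
Qed.

Hypothesis missT : forall v, exists2 N, max_matching N & v \notin cover N.

(** By [missT] the second disjunct fails for u = v, so reflexivity needs its own clause. Gallai's
    lemma enters as the fact that this is an equivalence relation relating adjacent vertices. *)
Definition inseparable u v :=
  (u == v) ||
  [forall M, max_matching M ==> ((u \in cover M) || (v \in cover M))].

Lemma inseparableC u v : inseparable u v = inseparable v u.
Proof.
rewrite /inseparable eq_sym; congr (_ || _).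
by apply: eq_forallb => M; rewrite orbC.
Qed.

Lemma inseparableP u v : u != v ->
  reflect (forall M, max_matching M -> u \notin cover M -> v \in cover M)
    (inseparable u v).
Proof.
rewrite /inseparable => /negPf -> /=.
apply: (iffP forall_inP) => h M mM; first by move/negPf => uM; have := h M mM; rewrite uM.
by case: (boolP (u \in _)) => // uM; rewrite (h M mM).
Qed.

(** A maximum matching missing u and w covers v, while every maximum matching missing v covers both
    u and w. By the exchange argument v is then never missed, against [missT]. *)
Lemma inseparable_trans v u w :
  inseparable u v -> inseparable v w -> inseparable u w.
Proof.
have [->//|nuv] := eqVneq u v; have [<-//|nvw] := eqVneq v w.
have [->|nuw] := eqVneq u w; first by rewrite /inseparable eqxx.
move=> Ruv Rvw; apply/inseparableP => // M mM uM; apply/negPn/negP => wM.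
have vM := inseparableP nuv Ruv M mM uM.
have [N mN vN] := missT v.
rewrite inseparableC in Ruv; rewrite eq_sym in nuv.
suff: v \in cover N by rewrite (negPf vN).
apply: (max_matching_exchange mM uM wM nuw vM _ mN) => L mL vL.
by rewrite (inseparableP nuv Ruv L) // (inseparableP nvw Rvw L).
Qed.

Lemma inseparable_edge u v : [set u; v] \in E -> inseparable u v.
Proof.
move=> uvE; have [->|nuv] := eqVneq u v; first by rewrite /inseparable eqxx.
apply/inseparableP => // M mM uM.
have [x] := max_matching_meets mM uvE.
by rewrite !inE => /orP[] /eqP-> // uM'; rewrite uM' in uM.
Qed.

(** M misses at most one vertex of each inseparability class, and its edges stay within classes. So
    the class of v has at most [2 * #|inner v| + 1] vertices; it contains v and its neighbours,
    which bounds the degree of v. The number a is the largest [#|inner v|]. *)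
Lemma gallai_edge_bound M : max_matching M ->
  exists2 a, a <= T & #|E| <= (2 * a + 1) * T.
Proof.
move=> mM; case/and3P: (mM) => sME tM /eqP cM.
pose cl v := [set w | inseparable v w].
pose inner v := [set e in M | e \subset cl v].
have card_cl v : #|cl v| <= 2 * #|inner v| + 1.
  rewrite -(cardsID (cover M)); apply: leq_add; last first.
    apply/card_le1P => x; rewrite !inE => /andP[xM vx] y; rewrite !inE.
    apply/andP/eqP => [[yM vy]|->//]; apply/eqP/negPn/negP => nyx.
    suff: x \in cover M by rewrite (negPf xM).
    suff Ryx : inseparable y x by apply: (inseparableP nyx Ryx M).
    by apply: inseparable_trans vx; rewrite inseparableC.
  have uI : uniform2 (inner v).
    by move=> e; rewrite inE => /andP[eM _]; apply: uE; apply: (subsetP sME).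
  have tI : trivIset (inner v).
    by apply: trivIset_sub tM; apply/subsetP => e; rewrite inE => /andP[].
  rewrite mulnC -card_cover_matching //; apply: subset_leq_card.
  apply/subsetP => x; rewrite inE => /andP[xv /bigcupP[e eM xe]].
  apply/bigcupP; exists e => //; rewrite inE eM; apply/subsetP => y ye.
  have eE := subsetP sME e eM.
  have [z _ defe] := edge_pair (uE eE) xe.
  move: ye xv; rewrite defe !inE => /orP[]/eqP-> // vx.
  by apply: inseparable_trans vx _; apply: inseparable_edge; rewrite -defe.
have deg v : #|neighbours E v| <= 2 * #|inner v|.
  suff: #|neighbours E v| < #|cl v| by have := card_cl v; lia.
  apply: proper_card; apply/properP; split.
    by apply/subsetP => w; rewrite !inE => /inseparable_edge.
  exists v; last exact: neighbours_irrefl.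
  by rewrite inE /inseparable eqxx.
exists (\max_v #|inner v|).
  apply/bigmax_leqP => v _; rewrite -cM; apply: subset_leq_card.
  by apply/subsetP => e; rewrite inE => /andP[].
have: 2 * #|E| <= 2 * \sum_v #|inner v|.
  by rewrite -handshake // big_distrr /=; apply: leq_sum.
rewrite leq_pmul2l // => /leq_trans; apply.
(* Double counting: an edge e of M is counted only by vertices v in the class of its ends, hence at
   most 2a + 1 times. *)
under eq_bigr => v _ do rewrite -sum1_card.
rewrite (exchange_big_dep (mem M)) /=; last by move=> v e _; rewrite inE => /andP[].
rewrite mulnC -cM -sum_nat_const; apply: leq_sum => e eM.
have /card_gt0P[x xe] : 0 < #|e| by rewrite (uE (subsetP sME e eM)).
rewrite sum1dep_card; apply: (@leq_trans #|cl x|); last first.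
  rewrite (leq_trans (card_cl x)) // leq_add2r leq_pmul2l //.
  exact: (leq_bigmax x).
apply: subset_leq_card; apply/subsetP => v; rewrite !inE => /andP[_ /subsetP/(_ x xe)].
by rewrite inE inseparableC.
Qed.

End Gallai.

(* The weak form of the Tutte-Berge formula that is needed: a bounds the number
   of matching edges in one component of E - S. *)
Lemma matching_edge_bound E T :
    uniform2 E ->
    (forall M, M \subset E -> trivIset M -> #|M| <= T) ->
  exists S a, #|S| + a <= T /\ #|delete E S| <= (2 * a + 1) * (T - #|S|).
Proof.
elim: T E => [|T IH] E uE maxT.
  exists set0, 0; rewrite cards0; split => //=.
  rewrite muln0 leqn0 cards_eq0; apply/eqP/setP => e; rewrite !inE.
  apply/negP => /andP[eE _].
  have: #|[set e]| <= 0; last by rewrite cards1.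
  apply: maxT; first by rewrite sub1set.
  by apply/trivIsetP => A B /set1P-> /set1P->; rewrite eqxx.
have [/existsP[M mM]|nomax] := boolP [exists M, max_matching E T.+1 M]; last first.
  have [||S [a [h1 h2]]] := IH E => //.
    move=> M sM tM; have := maxT M sM tM; rewrite leq_eqVlt ltnS => /orP[cM|//].
    by case/existsP: nomax; exists M; apply/and3P.
  exists S, a; split; first exact: leqW.
  by rewrite (leq_trans h2) // leq_mul2l leq_sub2r ?orbT.
(* Deleting a vertex that lies in every maximum matching lowers the bound to T, so such a v is put
   into S. If there is none, the Gallai bound applies with S empty. *)
have [/existsP[v /forall_inP hv]|miss] :=
  boolP [exists v, forall M, max_matching E T.+1 M ==> (v \in cover M)].
  pose E' := delete E [set v].
  have [||S [a [h1 h2]]] := IH E'.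
  - exact: uniform2_sub (delete_sub _ _) uE.
  - move=> N sN tN; have sNE := subset_trans sN (delete_sub _ _).
    have := maxT N sNE tN; rewrite leq_eqVlt ltnS => /orP[cN|//].
    have /bigcupP[e eN ve] : v \in cover N by apply: hv; apply/and3P.
    have := subsetP sN e eN; rewrite inE => /andP[_].
    by rewrite disjoint_sym disjoints1 ve.
  exists (v |: S), a.
  have cS : #|v |: S| <= #|S|.+1 by rewrite cardsU1 -add1n leq_add2r leq_b1.
  split; first by rewrite (leq_trans (leq_add cS (leqnn a))).
  have -> : delete E (v |: S) = delete E' S.
    apply/setP => e; rewrite !inE -andbA; congr (_ && _).
    by rewrite !(disjoint_sym e) !disjoints_subset subUset.
  by rewrite (leq_trans h2) // leq_mul2l -subSS leq_sub2l ?orbT.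
have [|a h1 h2] := @gallai_edge_bound E T.+1 uE maxT _ M mM.
  move=> v; move: miss; rewrite negb_exists => /forallP/(_ v).
  by rewrite negb_forall => /existsP[N]; rewrite negb_imply => /andP[mN vN]; exists N.
exists set0, a; rewrite cards0 subn0 add0n; split=> //.
by apply: leq_trans h2; apply: subset_leq_card; apply: delete_sub.
Qed.

End EdgeSets.

(** * Counting cliques *)

(** Convexity: by Pascal's rule the increments of ['C(_, s.+1)] are the values of ['C(_, s)], which
    do not decrease. *)
Lemma bin_convex q u k s : q <= u ->
  'C(u, s) + 'C(q + k, s) <= 'C(u + k, s) + 'C(q, s).
Proof.
move=> qu; elim: k => [|k IH]; first by rewrite !addn0.
case: s IH => [|s] IH; first by rewrite !bin0.
have := leq_bin2l s (leq_add qu (leqnn k)).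
by rewrite !addnS !binS; lia.
Qed.

Section Cliques.
Variable V : finType.
Implicit Types (E : {set {set V}}) (K e : {set V}) (v w : V).

(** For r at most 1 every r-set belongs, as it contains no pair. *)
Definition cliques E r : {set {set V}} :=
  [set K : {set V} | (#|K| == r) &&
     [forall e : {set V}, (e \subset K) && (#|e| == 2) ==> (e \in E)]].

Lemma cliquesP E r K :
  reflect (#|K| = r /\ forall e, e \subset K -> #|e| = 2 -> e \in E)
          (K \in cliques E r).
Proof.
rewrite inE; apply: (iffP andP) => -[/eqP cK hK]; split=> //.
- by move=> e eK ce; apply: (implyP (forallP hK e)); rewrite eK ce eqxx.
- by apply/forallP => e; apply/implyP => /andP[eK /eqP ce]; apply: hK.
Qed.

Lemma cliques_sub E r E' : E \subset E' -> cliques E r \subset cliques E' r.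
Proof.
move=> /subsetP sE; apply/subsetP => K /cliquesP[cK hK].
by apply/cliquesP; split=> // e eK ce; apply: sE; apply: hK.
Qed.

(** A clique avoiding v survives the deletion; one through v is determined by its other r + 1
    vertices, all neighbours of v. *)
Lemma card_cliques_vertex E v r :
  #|cliques E r.+2| <=
  #|cliques (delete E [set v]) r.+2| + 'C(#|neighbours E v|, r.+1).
Proof.
rewrite -(cardsID [set K : {set V} | v \in K]) addnC.
apply: leq_add.
  apply: subset_leq_card; apply/subsetP => K /setDP[/cliquesP[cK hK]].
  rewrite inE => vK; apply/cliquesP; split=> // e eK ce.
  rewrite inE hK //= disjoint_sym disjoints1.
  by apply: contra vK => ve; apply: (subsetP eK).
rewrite -cards_draws; set A := _ :&: _.
have injA : {in A &, injective (fun K => K :\ v)}.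
  move=> K L; rewrite !inE => /andP[_ vK] /andP[_ vL] eKL.
  by rewrite -(setD1K vK) eKL setD1K.
rewrite -(card_in_imset injA).
apply: subset_leq_card; apply/subsetP => L /imsetP[K /setIP[/cliquesP[cK hK]]].
rewrite inE => vK ->; rewrite inE.
have := cardsD1 v K; rewrite vK cK add1n => -[<-]; rewrite eqxx andbT.
apply/subsetP => w; rewrite !inE => /andP[nwv wK]; apply: hK.
  by apply/subsetP => z /set2P[] ->.
by rewrite cards2 eq_sym nwv.
Qed.

Lemma card_delete1 E v : uniform2 E ->
  #|E| = #|delete E [set v]| + #|neighbours E v|.
Proof.
move=> uE; rewrite -card_neighbours // -(cardsID [set e : {set V} | v \in e] E) addnC.
congr (_ + _); apply: eq_card => e; rewrite !inE ?[_ && (e \in _)]andbC //.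
by rewrite disjoint_sym disjoints1.
Qed.

(** If all positive degrees were at least p, a non-isolated vertex and its neighbours would be at
    least p + 1 vertices of degree at least p, which forces ['C(p.+1, 2)] edges. *)
Lemma exists_low_degree E p : uniform2 E -> E != set0 ->
  #|E| < 'C(p.+1, 2) -> exists2 v, 0 < #|neighbours E v| & #|neighbours E v| < p.
Proof.
move=> uE /set0Pn[e0 e0E] hE.
case: (boolP [exists v, 0 < #|neighbours E v| < p]).
  by case/existsP=> v /andP[]; exists v.
rewrite negb_exists => /forallP hdeg.
have big v w : w \in neighbours E v -> p <= #|neighbours E v|.
  move=> wv; have := hdeg v; rewrite card_gt0.
  have -> /= : neighbours E v != set0 by apply/set0Pn; exists w.
  by rewrite -leqNgt.
have /card_gt0P[v ve] : 0 < #|e0| by rewrite uE.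
have [w nwv defe] := edge_pair (uE _ e0E) ve.
have dv : p <= #|neighbours E v| by apply: (big v w); rewrite inE -defe.
suff: p.+1 * p <= 2 * #|E|.
  by move: hE; rewrite bin2 /=; move: #|E| => m; have := odd_double_half (p.+1 * p);
  clear; lia.
rewrite -handshake //.
apply: (@leq_trans (\sum_(x in v |: neighbours E v) #|neighbours E x|)); last first.
  by rewrite [leqRHS](bigID (mem (v |: neighbours E v))) /= leq_addr.
apply: (@leq_trans (\sum_(x in v |: neighbours E v) p)).
  by rewrite sum_nat_const cardsU1 neighbours_irrefl // leq_mul2r add1n ltnS dv orbT.
apply: leq_sum => x; rewrite in_setU1 => /orP[/eqP->//|].
by rewrite inE => vx; apply: (big x v); rewrite inE setUC.
Qed.

(* Deleting a vertex of least positive degree d, which is less than p, lowers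
   (p, q) to (p, q - d) or (p - 1, p - 1 + q - d), and destroys at most
   'C(d, r.+1) cliques. *)
Lemma kruskal_katona_cliques E p q r : uniform2 E -> q <= p ->
  #|E| <= 'C(p, 2) + q -> #|cliques E r.+2| <= 'C(p, r.+2) + 'C(q, r.+1).
Proof.
have [k] := ubnP #|E|; elim: k E p q => // k IH E p q hk uE qp hE.
have [E0|nE0] := eqVneq E set0.
  rewrite (_ : cliques E r.+2 = set0) ?cards0 //; apply/setP => K.
  rewrite in_set0; apply/cliquesP => -[cK hK].
  have [e] : exists e : {set V}, e \in [set A : {set V} | A \subset K & #|A| == 2].
    by apply/set0Pn; rewrite -card_gt0 cards_draws bin_gt0 cK.
  by rewrite inE => /andP[eK /eqP /(hK e eK)]; rewrite E0 inE.
(* For q = p, Pascal's rule turns the pair (p, p) into (p + 1, 0) without changing either bound. *)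
wlog qp' : p q qp hE / q < p.
  move=> hw; move: qp; rewrite leq_eqVlt => /orP[/eqP eqp|qp]; last exact: hw (ltnW qp) hE qp.
  subst q; have := hw p.+1 0; rewrite addn0 !binS bin1 !bin0n addn0; apply => //.
have [v d0 dp] : exists2 v, 0 < #|neighbours E v| & #|neighbours E v| < p.
  apply: exists_low_degree => //; rewrite binS bin1.
  by apply: leq_ltn_trans hE _; rewrite ltn_add2l.
have cE := card_delete1 v uE.
have uE' : uniform2 (delete E [set v]) by apply: uniform2_sub uE; apply: delete_sub.
apply: leq_trans (card_cliques_vertex E v r) _.
move: cE d0 dp (IH (delete E [set v])).
move: #|neighbours E v| #|delete E _| => d m cE d0 dp {}IH.
have hm : m < k by rewrite -ltnS (leq_trans _ hk) // ltnS cE -addn1 leq_add2l.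
have [dq|qd] := leqP d q.
  have hIH : #|cliques (delete E [set v]) r.+2| <= 'C(p, r.+2) + 'C(q - d, r.+1).
    by apply: IH => //; lia.
  have := @bin_convex 0 (q - d) d r.+1 (leq0n _).
  rewrite subnK // add0n bin0n; lia.
(* From here p is the former p - 1. As d exceeds q, the deletion uses up q and d - q of the p edges
   in ['C(p.+1, 2) = 'C(p, 2) + p]. *)
case: p qp hE qp' dp => // p qp hE qp' dp.
have hIH : #|cliques (delete E [set v]) r.+2| <=
           'C(p, r.+2) + 'C(p - (d - q), r.+1).
  by apply: IH => //; move: hE; rewrite binS bin1; lia.
have := @bin_convex q (p - (d - q)) (d - q) r.+1.
rewrite subnK ?subnKC //; [rewrite [in X in _ -> X]binS| lia | lia]; lia.
Qed.

End Cliques.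

(** * The arrow relation and the graphs Gnxy *)

Lemma edges_uniform2 (V : finType) (G : graph V) : uniform2 (edges G).
Proof. by move=> e eG; apply/eqP; apply: (forall_inP (edges_card2 G)). Qed.

Lemma imset_complete_edges (V : finType) l (f : 'I_l -> V) : injective f ->
  [set f @: (e : {set 'I_l}) | e in edges (complete_graph l)] =
  [set e : {set V} | (e \subset f @: [set: 'I_l]) && (#|e| == 2)].
Proof.
move=> injf; apply/setP => e; rewrite inE; apply/imsetP/andP.
  case=> d; rewrite inE andbT => cd ->.
  by rewrite card_imset // imsetS // subsetT.
case=> ef ce; have defe : e = f @: (f @^-1: e).
  apply/setP => x; apply/idP/imsetP => [xe|[i]]; last by rewrite inE => fi ->.
  have /imsetP[i _ defx] := subsetP ef x xe.
  by exists i => //; rewrite inE -defx.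
exists (f @^-1: e) => //; rewrite inE andbT.
by rewrite defe card_imset in ce.
Qed.

(** A copy of a complete graph is a vertex set with all its pairs, so [h] matches cliques with
    copies. *)
Lemma num_cliquesE l (V : finType) (G : graph V) :
  num_cliques l G = #|cliques (edges G) l|.
Proof.
pose h (K : {set V}) := (K, [set e : {set V} | (e \subset K) && (#|e| == 2)]).
have injh : injective h by move=> K L [].
rewrite /num_cliques /num_copies -(card_imset _ injh); apply: eq_card => KE.
apply/imsetP/imsetP => -[].
  move=> f; rewrite inE => /andP[/injectiveP injf].
  rewrite imset_complete_edges // => sub ->; exists (f @: [set: 'I_l]) => //.
  apply/cliquesP; split; first by rewrite card_imset // cardsT card_ord.
  by move=> e eK ce; apply: (subsetP sub); rewrite inE eK ce eqxx.
move=> K /cliquesP[cK hK] ->.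
pose f : {ffun 'I_l -> V} := [ffun i => enum_val (cast_ord (esym cK) i)].
have injf : injective f.
  by move=> i j; rewrite !ffunE => /enum_val_inj/cast_ord_inj.
have imf : f @: [set: 'I_l] = K.
  apply/eqP; rewrite eqEcard card_imset // cardsT card_ord cK leqnn andbT.
  by apply/subsetP => x /imsetP[i _ ->]; rewrite ffunE enum_valP.
exists f; last by rewrite imset_complete_edges // imf.
rewrite inE; apply/andP; split; first exact/injectiveP.
rewrite imset_complete_edges // imf; apply/subsetP => e; rewrite inE.
by case/andP=> eK /eqP ce; apply: hK.
Qed.

Lemma exists_subset_card (T : finType) (A : {set T}) k : k <= #|A| ->
  exists2 B : {set T}, B \subset A & #|B| = k.
Proof.
move=> kA; have : 0 < #|[set B : {set T} | B \subset A & #|B| == k]|.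
  by rewrite cards_draws bin_gt0.
by case/card_gt0P=> B; rewrite inE => /andP[BA /eqP cB]; exists B.
Qed.

(** Passes from colourings of the subtype [edge G] to colourings of all vertex sets, with j0 as
    default colour off the edges. A matching with more than [t j] edges contains one with exactly
    [t j]. *)
Lemma not_arrowsP (V : finType) (G : graph V) q (t : 'I_q -> nat) (j0 : 'I_q) :
  reflect
    (exists c : {set V} -> 'I_q, forall (M : {set {set V}}) (j : 'I_q),
       M \subset edges G -> trivIset M -> {in M, forall e, c e = j} -> #|M| < t j)
    (~~ arrows G t).
Proof.
apply: (iffP idP) => [|[c hc]].
  rewrite negb_forall => /existsP[c].
  rewrite negb_exists => /forallP hc.
  pose c' (e : {set V}) := if insub e is Some e' then c (e' : edge G) else j0.
  exists c' => M j sM tM cM; rewrite ltnNge; apply/negP => tj.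
  have [M1 sM1 cM1] := exists_subset_card tj.
  pose M2 : {set edge G} := [set e | val e \in M1].
  have valM2 : val @: M2 = M1.
    apply/setP => e; apply/imsetP/idP => [[e']|eM1]; first by rewrite inE => ? ->.
    have eG : e \in edges G by apply: (subsetP sM); apply: (subsetP sM1).
    by exists (Sub e eG); rewrite ?inE SubK.
  have := hc j; rewrite negb_exists => /forallP/(_ M2)/negP; apply.
  apply/and3P; split.
  - apply/forall_inP => e; rewrite inE => eM; apply/forall_inP => f.
    rewrite inE => fM; apply/implyP => nef.
    by move/trivIsetP: tM; apply; rewrite ?(inj_eq val_inj) // (subsetP sM1).
  - by rewrite -cM1 -valM2 (card_imset _ val_inj).
  - apply/forall_inP => e; rewrite inE => eM; apply/eqP.
    by rewrite -(cM (val e)) ?(subsetP sM1) // /c' valK.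
rewrite negb_forall; apply/existsP; exists [ffun e : edge G => c (val e)].
rewrite negb_exists; apply/forallP => j; rewrite negb_exists; apply/forallP => M.
apply/negP => /and3P[mM /eqP cM /forall_inP hM].
have: #|val @: M| < t j; last by rewrite (card_imset _ val_inj) cM ltnn.
apply: hc.
- by apply/subsetP => e /imsetP[e' _ ->]; apply: valP.
- apply/trivIsetP => e f /imsetP[e' eM ->] /imsetP[f' fM ->] nef.
  have := forall_inP (forall_inP mM e' eM) f' fM.
  by move/implyP; apply; apply: contra nef => /eqP->.
- by move=> e /imsetP[e' eM ->]; have := hM e' eM; rewrite ffunE => /eqP.
Qed.

Lemma card_ord_interval n k m : k + m <= n ->
  #|[set i : 'I_n | k <= i < k + m]| = m.
Proof.
move=> kmn.
have lt (i : 'I_m) : k + i < n by apply: leq_trans kmn; rewrite ltn_add2l.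
have injf : injective (fun i => Ordinal (lt i)).
  by move=> i j /(congr1 val) /= /addnI/val_inj.
rewrite -[RHS]card_ord -cardsT -(card_imset _ injf); apply: eq_card => i.
rewrite inE; apply/andP/imsetP => [[ki im]|[j _ ->]] /=; last first.
  by rewrite leq_addr ltn_add2l.
have im' : i - k < m by rewrite ltn_subLR.
by exists (Ordinal im') => //; apply: val_inj; rewrite /= subnKC.
Qed.

(** Greedy: once all of Y but one vertex v is distributed, some colour is still below its capacity
    and can take v. *)
Lemma distribute (V : finType) q (s : 'I_q -> nat) (j0 : 'I_q) (Y : {set V}) :
  #|Y| <= \sum_j s j ->
  exists f : V -> 'I_q, forall j, #|[set v in Y | f v == j]| <= s j.
Proof.
have [k] := ubnP #|Y|; elim: k Y => // k IH Y hk hY.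
have [->|/set0Pn[v vY]] := eqVneq Y set0.
  exists (fun _ => j0) => j; rewrite (_ : [set _ in _ | _] = set0) ?cards0 //.
  by apply/setP => v; rewrite !inE.
have cY := cardsD1 v Y; rewrite vY add1n in cY.
have [||f hf] := IH (Y :\ v); [by rewrite -ltnS -cY|by rewrite (leq_trans _ hY) // cY|].
have [j hj] : exists j, #|[set w in Y :\ v | f w == j]| < s j.
  apply/existsP/contraT; rewrite negb_exists => /forallP full.
  suff: \sum_j s j <= #|Y :\ v| by rewrite leqNgt -cY hY.
  rewrite -[leqRHS]sum1_card (partition_big f predT) //=.
  apply: leq_sum => j _; rewrite sum1dep_card.
  have := full j; rewrite -leqNgt => /leq_trans; apply.
  by apply: subset_leq_card; apply/subsetP => w; rewrite !inE.
exists (fun w => if w == v then j else f w) => i.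
have [eij|nij] := eqVneq i j; last first.
  apply: leq_trans (hf i); apply: subset_leq_card; apply/subsetP => w.
  rewrite !inE; case: (w == v) => /=; last by [].
  by rewrite eq_sym (negPf nij) andbF.
subst i; apply: leq_trans hj.
rewrite -[leqRHS](_ : #|v |: [set w in Y :\ v | f w == j]| = _); last first.
  by rewrite cardsU1 !inE eqxx.
apply: subset_leq_card; apply/subsetP => w; rewrite !inE.
by case: (w == v).
Qed.

Lemma Gnxy_not_arrows n q (t : 'I_q -> nat) a y (jm : 'I_q) :
    (forall j, 0 < t j) -> a < t jm -> y + a <= \sum_j (t j).-1 ->
    2 * a + 1 + y <= n ->
  ~~ arrows (Gnxy n (2 * a + 1) y) t.
Proof.
move=> ht ha hy hn; apply/(not_arrowsP _ _ jm).
set x := 2 * a + 1 in hn *.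
pose Y := [set i : 'I_n | x <= i < x + y].
(* Colour jm reserves a edges for X, where 2a + 1 vertices carry no larger matching. *)
pose s j := if j == jm then (t j).-1 - a else (t j).-1.
have cY : #|Y| <= \sum_j s j.
  rewrite card_ord_interval // (bigD1 jm) //=; move: hy; rewrite (bigD1 jm) //=.
  rewrite /s eqxx [\sum_(_ < _ | _) (if _ then _ else _)](eq_bigr (fun j => (t j).-1)); last by move=> j /negPf->.
  by move: (\sum_(j | _) _) (t jm) ha => S tj; lia.
have [f hf] := distribute jm cY.
(* Even if both ends lie in Y, an edge of colour j that meets Y meets the fibre of f over j, so this
   fibre is a transversal of such a matching. *)
exists (fun e => if [pick v in e :&: Y] is Some v then f v else jm) => M j sM tM cM.
rewrite -(cardsID [set e : {set 'I_n} | e :&: Y != set0] M).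
have tM1 := trivIset_sub (subsetIl M [set e : {set 'I_n} | e :&: Y != set0]) tM.
have tM2 := trivIset_sub (subsetDl M [set e : {set 'I_n} | e :&: Y != set0]) tM.
have bound1 : #|M :&: [set e : {set 'I_n} | e :&: Y != set0]| <= s j.
  apply: leq_trans (hf j); apply: leq_card_transversal => // e.
  rewrite !inE => /andP[eM /set0Pn[v veY]]; have := cM e eM.
  case: pickP => [w|/(_ v)]; last by rewrite veY.
  rewrite !inE => /andP[we wY] fw.
  by apply/set0Pn; exists w; rewrite !inE we wY fw eqxx.
have M2P e : e \in M :\: [set e : {set 'I_n} | e :&: Y != set0] ->
    [/\ e \in M, j = jm & e \subset [set i : 'I_n | i < x]].
  rewrite !inE negbK => /andP[/eqP e0 eM]; split=> //.
    rewrite -(cM e eM); case: pickP => // v; by rewrite e0 inE.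
  by have := subsetP sM e eM; rewrite !inE e0 eqxx orbF => /andP[].
have [ej|nj] := eqVneq j jm; last first.
  rewrite (_ : _ :\: _ = set0) ?cards0 ?addn0; last first.
    by apply/setP => e; rewrite in_set0; apply/negP => /M2P[_ /eqP]; rewrite (negPf nj).
  by apply: leq_ltn_trans bound1 _; rewrite /s (negPf nj) prednK.
have bound2 : #|M :\: [set e : {set 'I_n} | e :&: Y != set0]| <= a.
  have cX : #|[set i : 'I_n | i < x]| = x.
    rewrite -[RHS](@card_ord_interval n 0 x); last exact: leq_trans (leq_addr _ _) hn.
    by apply: eq_card => i; rewrite !inE.
  have: #|M :\: [set e : {set 'I_n} | e :&: Y != set0]| * 2 <= x.
    rewrite -card_cover_matching //; last first.
      by move=> e /M2P[eM _ _]; apply: (@edges_uniform2 _ (Gnxy n x y)); apply: (subsetP sM).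
    by rewrite -[leqRHS]cX; apply: subset_leq_card; apply/bigcupsP => e /M2P[].
  by rewrite /x; move: #|_| => k; clear; lia.
apply: leq_ltn_trans (leq_add bound1 bound2) _.
by rewrite /s ej eqxx; move: (ht jm) ha; move: (t jm) => T; clear; lia.
Qed.

(** * Comparing clique counts by the part outside Y *)

(** K corresponds to the pair of K inside Y and K outside Y; the inner part is an arbitrary (l -
    r)-subset of Y. *)
Lemma card_sets_split (V : finType) (Y : {set V}) (P : pred {set V}) l :
  #|[set K : {set V} | (#|K| == l) && P (K :\: Y)]| =
  \sum_(r < l.+1) 'C(#|Y|, l - r) *
    #|[set R : {set V} | [&& #|R| == r, R \subset ~: Y & P R]]|.
Proof.
pose rk (K : {set V}) : 'I_l.+1 := inord #|K :\: Y|.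
rewrite -sum1dep_card (partition_big rk predT) //=; apply: eq_bigr => r _.
rewrite -cards_draws -cardsX sum1dep_card.
pose h (K : {set V}) := (K :&: Y, K :\: Y).
have injh : injective h by move=> K L [e1 e2]; rewrite -(setID K Y) e1 e2 setID.
have rlt := ltn_ord r.
rewrite -(card_imset _ injh); apply: eq_card => -[A R]; rewrite !inE /=.
apply/imsetP/andP.
  case=> K; rewrite inE => /andP[/andP[/eqP cK PK] /eqP rK] [-> ->].
  have cKY := cardsID Y K.
  have rK' : #|K :\: Y| = r.
    by rewrite -rK inordK // ltnS -cK subset_leq_card // subsetDl.
  rewrite subsetIr /= PK rK' eqxx andbT /=; split.
    by rewrite -rK' -[X in X - _]cK -[X in X - _]cKY addnK.
  by rewrite -disjoints_subset -setI_eq0 setIDAC setDIl setDv setI0.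
case=> /andP[AY /eqP cA] /and3P[/eqP cR RY PR].
have AR1 : (A :|: R) :&: Y = A.
  rewrite setIUl (setIidPl AY) (_ : R :&: Y = set0) ?setU0 //.
  by apply/eqP; rewrite setI_eq0 disjoints_subset.
have AR2 : (A :|: R) :\: Y = R.
  rewrite setDUl (_ : A :\: Y = set0) ?set0U; last by apply/eqP; rewrite setD_eq0.
  by rewrite setDE; apply/setIidPl.
exists (A :|: R); last by rewrite /h AR1 AR2.
rewrite inE AR2 PR andbT; apply/andP; split.
  by rewrite -(cardsID Y) AR1 AR2 cA cR subnK.
by apply/eqP; apply: val_inj; rewrite /rk /= AR2 cR inordK.
Qed.

(** Of the b + #|Y| joined vertices, the first b together with X form the clique D on m vertices,
    and the rest form Y', which plays the role of Y. Both counts are split by the number r of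
    vertices outside Y or Y'. For r at most 1 all r-sets are allowed in G as an upper bound and do
    occur in [Gnxy]; for larger r, Kruskal-Katona compares G - Y with D. *)
Lemma cliques_le_Gnxy n l (G : graph 'I_n) (Y : {set 'I_n}) x b :
    x + b + #|Y| <= n -> #|delete (edges G) Y| <= 'C(x + b, 2) ->
  #|cliques (edges G) l| <= #|cliques (edges (Gnxy n x (b + #|Y|))) l|.
Proof.
move=> hn hE; set y := #|Y| in hn *; set m := x + b in hn hE *.
pose Y' := [set i : 'I_n | m <= i < m + y].
pose D := [set i : 'I_n | i < m].
have cY' : #|Y'| = y by rewrite card_ord_interval.
have cD : #|D| = m.
  rewrite -[RHS](@card_ord_interval n 0 m); last exact: leq_trans (leq_addr _ _) hn.
  by apply: eq_card => i; rewrite !inE.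
pose P (R : {set 'I_n}) := R \in cliques (delete (edges G) Y) #|R|.
pose P' (R : {set 'I_n}) := (#|R| <= 1) || (R \subset D).
apply: (@leq_trans #|[set K : {set 'I_n} | (#|K| == l) && P (K :\: Y)]|).
  apply: subset_leq_card; apply/subsetP => K /cliquesP[cK hK].
  rewrite inE cK eqxx; apply/cliquesP; split=> // e eKY ce.
  rewrite inE hK //; last exact: subset_trans eKY (subsetDl _ _).
  by rewrite disjoints_subset (subset_trans eKY) // setDE subsetIr.
apply: (@leq_trans #|[set K : {set 'I_n} | (#|K| == l) && P' (K :\: Y')]|); last first.
  apply: subset_leq_card; apply/subsetP => K; rewrite inE => /andP[/eqP cK PK].
  apply/cliquesP; split=> // e eK ce; rewrite inE ce eqxx /=.
  rewrite orbC; case: eqVneq => //= eY.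
  have eKY : e \subset K :\: Y'.
    apply/subsetP => i ie; rewrite in_setD (subsetP eK) // andbT.
    apply/negP; rewrite inE => /andP[mi im].
    have : i \in e :&: [set i : 'I_n | x <= i < x + (b + y)].
      by rewrite !inE ie addnA im andbT (leq_trans _ mi) // leq_addr.
    by rewrite eY inE.
  case/orP: PK => [c1|/subsetP sD].
    by have := leq_trans (subset_leq_card eKY) c1; rewrite ce.
  apply/subsetP => i ie; have := sD i (subsetP eKY i ie); rewrite !inE => im.
  rewrite ltnNge; apply/negP => xi.
  have : i \in e :&: [set i : 'I_n | x <= i < x + (b + y)].
    by rewrite !inE ie xi addnA (leq_trans im) // leq_addr.
  by rewrite eY inE.
rewrite !card_sets_split cY'; apply: leq_sum => r _; rewrite leq_mul2l.
apply/orP; right; have [r1|r2] := leqP r 1.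
  apply: (@leq_trans 'C(#|~: Y|, r)).
    rewrite -cards_draws; apply: subset_leq_card; apply/subsetP => R.
    by rewrite !inE => /and3P[-> ->].
  have -> : #|~: Y| = #|~: Y'|.
    by apply: (@addnI #|Y|); rewrite cardsC -[#|Y|]cY' cardsC.
  rewrite -cards_draws; apply: subset_leq_card; apply/subsetP => R.
  by rewrite !inE => /andP[-> /eqP cR]; rewrite /P' cR eqxx r1.
case: (nat_of_ord r) r2 => [|[|{}r]] // _.
apply: (@leq_trans 'C(m, r.+2)).
  apply: (@leq_trans #|cliques (delete (edges G) Y) r.+2|).
    apply: subset_leq_card; apply/subsetP => R; rewrite inE.
    by case/and3P=> /eqP cR _; rewrite /P cR.
  have := @kruskal_katona_cliques _ (delete (edges G) Y) m 0 r.
  rewrite !addn0; apply=> //.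
  by apply: uniform2_sub (@edges_uniform2 _ G); apply: delete_sub.
rewrite -cD -cards_draws; apply: subset_leq_card; apply/subsetP => R.
rewrite !inE => /andP[RD cR]; rewrite cR /P' RD orbT andbT /=.
apply: subset_trans RD _; apply/subsetP => i; rewrite !inE => im.
by rewrite leqNgt im.
Qed.

(* The set Y and the number a collect the deleted sets and the largest block of
   the structure given by matching_edge_bound for each colour class. *)
Lemma not_arrows_structure (V : finType) (G : graph V) q (t : 'I_q -> nat) :
    0 < q -> (forall j, 0 < t j) -> ~~ arrows G t ->
  exists (Y : {set V}) (a : nat) (j : 'I_q),
    [/\ a < t j, #|Y| + a <= \sum_i (t i).-1
      & #|delete (edges G) Y| <= (2 * a + 1) * (\sum_i (t i).-1 - #|Y|)].
Proof.
move=> q0 ht; pose j0 := Ordinal q0; case/(not_arrowsP _ _ j0) => c hc.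
pose E j := [set e in edges G | c e == j].
have sE j : E j \subset edges G by apply/subsetP => e; rewrite inE => /andP[].
have /fin_all_exists[p hp] : forall j, exists p : {set V} * nat,
    #|p.1| + p.2 <= (t j).-1 /\
    #|delete (E j) p.1| <= (2 * p.2 + 1) * ((t j).-1 - #|p.1|).
  move=> j.
  have [||S [a hSa]] := @matching_edge_bound _ (E j) (t j).-1; last by exists (S, a).
    exact: uniform2_sub (sE j) (@edges_uniform2 _ G).
  move=> M sM tM; rewrite -ltnS prednK //; apply: hc => //.
    exact: subset_trans sM (sE j).
  by move=> e /(subsetP sM); rewrite inE => /andP[_ /eqP].
pose S j := (p j).1; pose a j := (p j).2.
have hS j : #|S j| + a j <= (t j).-1 by case: (hp j).
have hD j : #|delete (E j) (S j)| <= (2 * a j + 1) * ((t j).-1 - #|S j|) by case: (hp j).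
have {hp} SleT j : #|S j| <= (t j).-1 by apply: leq_trans (hS j); apply: leq_addr.
have [jm am] : {jm | \max_j a j = a jm} by apply: eq_bigmax; rewrite card_ord.
pose Y := \bigcup_j S j.
have cY : #|Y| <= \sum_j #|S j|.
  rewrite /Y; elim/big_rec2: _ => [|j k A _ hA]; first by rewrite cards0.
  by rewrite (leq_trans (leq_card_setU _ _)) // leq_add2l.
exists Y, (a jm), jm; split.
- by rewrite -[ltnRHS](prednK (ht jm)) ltnS (leq_trans _ (hS jm)) // leq_addl.
- apply: leq_trans (leq_add cY (leqnn _)) _.
  rewrite (bigD1 jm) //= [leqRHS](bigD1 jm) //= addnAC leq_add //.
  exact: leq_sum.
- apply: (@leq_trans ((2 * a jm + 1) * (\sum_i (t i).-1 - \sum_i #|S i|))); last first.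
    by rewrite leq_mul2l leq_sub2l ?orbT.
  (* The edges avoiding Y are split by colour: those of colour j avoid [S j], and [a j] is at most
     [a jm]. *)
  rewrite -sumnB // big_distrr /= -sum1_card (partition_big c predT) //=.
  apply: leq_sum => j _; rewrite sum1dep_card.
  apply: (@leq_trans #|delete (E j) (S j)|).
    apply: subset_leq_card; apply/subsetP => e; rewrite !inE.
    case/andP=> /andP[eG eY] cej; rewrite eG cej /=.
    by apply: disjointWr eY; apply: bigcup_sup.
  rewrite (leq_trans (hD j)) // leq_mul2r leq_add2r leq_mul2l /=.
  by rewrite -am (leq_bigmax j) orbT.
Qed.

(** * Choice of x and y *)

Lemma not_arrows_le_Gnxy q n l (t : 'I_q -> nat) (G : graph 'I_n) :
    0 < q -> 0 < n -> (forall j, 0 < t j) -> ~~ arrows G t ->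
  exists x y : nat,
    [/\ 1 <= x <= 2 * (\max_(j < q) t j) - 1, x + y <= n,
        ~~ arrows (Gnxy n x y) t & num_cliques l G <= num_cliques l (Gnxy n x y)].
Proof.
move=> q0 n0 ht nG.
have [Y [a [j [aj Ya hY]]]] := not_arrows_structure q0 ht nG.
have tj : t j <= \max_i t i by apply: (leq_bigmax j).
set N := \sum_i (t i).-1 in Ya hY.
have xb a' : a' <= a -> 1 <= 2 * a' + 1 <= 2 * (\max_i t i) - 1.
  by move: aj tj; move: (\max_i t i) (t j) => u v; clear; lia.
rewrite num_cliquesE.
(* The threshold is x + y for x = 2a + 1 and y = N - a. *)
have [small|big] := leqP n (N + a + 1).
  (* The complete graph is then itself of the form Gnxy n x y. *)
  have [a' [y [a'a ya' xy]]] : exists a' y, [/\ a' <= a, y + a' <= N & 2 * a' + 1 + y = n].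
    (* Up to N + 1 vertices a single vertex serves as X. Beyond that, a' solves 2a' + 1 + (N - a') =
       n, and [small] gives a' at most a. *)
    have [nN|Nn] := leqP n N.+1.
      by exists 0, n.-1; move: nN n0; clear; split; lia.
    exists (n - N.+1), (N - (n - N.+1)).
    by move: Ya Nn small; move: #|Y| => y0; clear; split; lia.
  exists (2 * a' + 1), y; rewrite xb //; split; rewrite ?xy //.
    by apply: (@Gnxy_not_arrows _ _ _ _ _ j) => //; [apply: leq_ltn_trans aj|rewrite xy].
  rewrite num_cliquesE; apply: subset_leq_card; apply: cliques_sub.
  apply/subsetP => e eG; rewrite inE (edges_uniform2 eG) eqxx /=.
  rewrite orbC; case: eqVneq => //= e0; apply/subsetP => i ie; rewrite inE ltnNge.
  apply/negP => xi; have : i \in e :&: [set i : 'I_n | 2 * a' + 1 <= i < 2 * a' + 1 + y].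
    by rewrite !inE ie xi xy ltn_ord.
  by rewrite e0 inE.
(* The slack b in [Ya] makes y = b + #|Y| equal to N - a, the largest value for which
   [Gnxy_not_arrows] applies. *)
have [b defN] : exists b, N = #|Y| + a + b.
  by exists (N - (#|Y| + a)); rewrite subnKC.
exists (2 * a + 1), (b + #|Y|); rewrite xb //; split=> //.
- by move: big; rewrite defN; move: #|Y| => y0; clear; lia.
- apply: (@Gnxy_not_arrows _ _ _ _ _ j) => //.
    by rewrite -/N defN; move: #|Y| => y0; clear; lia.
  by move: big; rewrite defN; move: #|Y| => y0; clear; lia.
rewrite num_cliquesE; apply: cliques_le_Gnxy.
  by move: big; rewrite defN; move: #|Y| => y0; clear; lia.
apply: leq_trans hY _; rewrite defN -addnA addKn.
(* For b = 0 both sides are (2a + 1)a; each step adds 2a + 1 on the left and 2a + 1 + b on the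
   right. *)
elim: b {defN} => [|b IH]; first by rewrite !addn0 addn1 bin2 [_.-1]/= mulnCA [X in X./2]mul2n doubleK.
by rewrite [a + _]addnS [_ + b.+1]addnS mulnS binS bin1 [leqLHS]addnC leq_add // leq_addr.
Qed.

Theorem theorem1p1 (q n l : nat) (t : 'I_q -> nat)
    (hq : 1 <= q) (hl : 2 <= l) (hln : l <= n) (ht : forall j : 'I_q, 0 < t j) :
  exists x y : nat,
    [/\ 1 <= x <= 2 * (\max_(j < q) t j) - 1,
        x + y <= n,
        ~~ arrows (Gnxy n x y) t
      & num_cliques l (Gnxy n x y) = GRT l n t].
Proof.
have n0 : 0 < n by apply: leq_trans hln; apply: ltnW.
have [G nG defm] : {G : graph 'I_n | ~~ arrows G t & GRT l n t = num_cliques l G}.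
  (* This edgeless graph makes the range of the maximum nonempty, so that some G attains it. *)
  apply: eq_bigmax_cond; apply/card_gt0P; exists (Gnxy n (2 * 0 + 1) 0).
  exact: (@Gnxy_not_arrows _ _ _ _ _ (Ordinal hq)).
have [x [y [hx hxy nA hle]]] := not_arrows_le_Gnxy l hq n0 ht nG.
exists x, y; split=> //; apply/eqP; rewrite eqn_leq {2}defm hle andbT.
by rewrite /GRT; apply: (leq_bigmax_cond (F := fun H : graph 'I_n => num_cliques l H)).
Qed.
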